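(* Let $n\ge 2$. There is a bijection $\Phi$ from the set of $n\times n$ permutation matrices to the set of TSSCPP boolean triangles of order $n$ with weakly decreasing rows such that for every permutation matrix $P$, writing $b=\Phi(P)$: (i) the number of entries of $b$ equal to $0$ equals the inversion number of $P$; (ii) if the $1$ in the last row of $P$ lies in column $k$, then exactly $n-k$ of the zeros of $b$ lie in its last row (row $n-1$); (iii) if the $1$ in the last column of $P$ lies in row $\ell$, then the lowest $1$ in diagonal $n-1$ of $b$ (i.e. among the entries $b_{1,n-1},b_{2,n-1},\dots,b_{n-1,n-1}$) is in row $\ell-1$, that is, $b_{i,n-1}=0$ for all $\ell\le i\le n-1$ and, if $\ell\geq 2$, $b_{\ell-1,n-1}=1$.
   Context: A TSSCPP boolean triangle of order $n$ is an array $\{b_{i,j}\}$ indexed by $1\leq i\leq n-1$, $n-i\leq j\leq n-1$ (row $i$ has the $i$ entries $b_{i,n-i},\dots,b_{i,n-1}$), with entries in $\{0,1\}$, such that for all $j$ and all $i'$ with $j\le i'\le n-1$ the diagonal partial sums satisfy $$1+\sum_{i=j+1}^{i'} b_{i,n-j-1} \;\geq\; \sum_{i=j}^{i'} b_{i,n-j},$$ where sums over empty index ranges are $0$. Its rows are weakly decreasing if $b_{i,j}\ge b_{i,j+1}$ whenever both entries exist. An $n\times n$ permutation matrix $P$ corresponds to the permutation $\sigma$ with $P_{i,\sigma(i)}=1$; its inversion number is the number of pairs $i<j$ with $\sigma(j)<\sigma(i)$. In (iii), the case $\ell=1$ means that diagonal $n-1$ contains no $1$. *)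

(* Defs.v *)
From HB Require Import structures.
From mathcomp Require Import all_boot all_order fingroup perm all_algebra.

Set Implicit Arguments.
Unset Strict Implicit.
Unset Printing Implicit Defensive.

(* (i, j) with n - i <= j <= n - 1, for row i and column (or diagonal)
   j; this forces 1 <= i, since row 0 has no admissible j < n. *)
Definition tri_pos (n : nat) := {p : 'I_n * 'I_n | n - p.1 <= p.2}.

Definition tri_row (n : nat) (p : tri_pos n) : nat := (val p).1.
Definition tri_col (n : nat) (p : tri_pos n) : nat := (val p).2.

Definition bool_array (n : nat) := {ffun tri_pos n -> bool}.

(* b_{i,j}, read as 0 when (i, j) is not a position of the array. *)
Definition entry (n : nat) (b : bool_array n) (i j : nat) : bool :=
  [exists p : tri_pos n, [&& tri_row p == i, tri_col p == j & b p]].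

Lemma entryE (n : nat) (b : bool_array n) (p : tri_pos n) :
  entry b (tri_row p) (tri_col p) = b p.
Proof.
apply/existsP/idP => [[q /and3P[/eqP rq /eqP cq bq]]|bp]; last first.
  by exists p; rewrite !eqxx.
suff -> : p = q by [].
apply/val_inj; case: p q rq cq {bq} => [[i j] pij] [[k l] pkl].
by rewrite /tri_row /tri_col /= => /val_inj-> /val_inj->.
Qed.

(* For j = n - 1 the left-hand sum is empty; diagonal 0 does not exist. *)
Definition is_tsscpp (n : nat) (b : bool_array n) : bool :=
  [forall j : 'I_n, forall i' : 'I_n, (1 <= j <= i') ==>
    (\sum_(j <= i < i'.+1) entry b i (n - j)
       <= 1 + \sum_(j.+1 <= i < i'.+1) entry b i (n - j - 1))].

Definition rows_decreasing (n : nat) (b : bool_array n) : bool :=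
  [forall p : tri_pos n, forall q : tri_pos n,
    (tri_row p == tri_row q) && (tri_col q == (tri_col p).+1) ==> (b q <= b p)].

Definition decreasing_tsscpp (n : nat) :=
  {b : bool_array n | is_tsscpp b && rows_decreasing b}.

(* perm_mx s has its 1 of row i in column s i. *)
Definition permutation_matrix (n : nat) := {P : 'M[int]_n | is_perm_mx P}.

Definition inversion_number (n : nat) (s : 'S_n) : nat :=
  #|[set p : 'I_n * 'I_n | (p.1 < p.2) && (s p.2 < s p.1)]|.

Definition num_zeros (n : nat) (b : bool_array n) : nat :=
  #|[set p : tri_pos n | ~~ b p]|.

Definition num_zeros_row (n : nat) (b : bool_array n) (i : nat) : nat :=
  #|[set p : tri_pos n | (tri_row p == i) && ~~ b p]|.

(* Main.v *)
Require Import Defs.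
From mathcomp Require Import all_boot all_order fingroup perm all_algebra.
From mathcomp Require Import zify.

(** A weakly decreasing row [i] is determined by its number [e_i <= i] of
    zeros, and weak decrease alone forces the diagonal inequalities, so the
    triangles amount to inversion sequences, [0 <= e_i <= i].  The bijection
    sends [s] to its Lehmer code [e_i = #{j < i | s j > s i}]: the code of
    [s] sums to the inversion number, its last term counts the values above
    the last value of [s], and its last zero is at the position of the maximum
    of [s]. *)

Set Implicit Arguments.
Unset Strict Implicit.
Unset Printing Implicit Defensive.

Import Order.TTheory.

Lemma decreasing_pred_count m n (a : pred nat) j :
    (forall k l, m <= k <= l -> l < n -> a l -> a k) -> m <= j < n ->
  a j = (j + count (predC a) (index_iota m n) < n).
Proof.
move=> a_decr /andP[mj jn].
have -> : index_iota m n = iota m (j - m) ++ iota j (n - j).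
  by rewrite -{2}(subnKC mj) -iotaD; congr iota; lia.
rewrite count_cat; apply/idP/idP => [aj|].
  have a_below : {in iota m (j - m), predC a =1 pred0}.
    move=> k; rewrite mem_iota => k_range /=; apply/negbF.
    by apply: a_decr aj; lia.
  have -> : n - j = (n - j.+1).+1 by lia.
  have := count_size (predC a) (iota j.+1 (n - j.+1)).
  by rewrite (eq_in_count a_below) count_pred0 size_iota /= aj; lia.
apply: contraTT => naj.
have a_above : {in iota j (n - j), predC a =1 predT}.
  move=> k; rewrite mem_iota => k_range /=.
  by apply: contraNT naj => /negPn; apply: a_decr; lia.
by rewrite (eq_in_count a_above) count_predT size_iota; lia.
Qed.

Lemma count_threshold m n e : e <= n - m ->
  count (fun j => n <= j + e) (index_iota m n) = e.
Proof.
move=> e_le; rewrite /index_iota -(subnK e_le) iotaD count_cat.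
have below : {in iota m (n - m - e), (fun j => n <= j + e) =1 pred0}.
  by move=> j; rewrite mem_iota /=; lia.
have above : {in iota (m + (n - m - e)) e, (fun j => n <= j + e) =1 predT}.
  by move=> j; rewrite mem_iota /=; lia.
rewrite (eq_in_count below) count_pred0.
by rewrite (eq_in_count above) count_predT size_iota.
Qed.

Lemma card_ord_ltn n k : k <= n -> #|[set j : 'I_n | j < k]| = k.
Proof.
move=> k_n; rewrite -sum1dep_card -(big_ord_widen n (fun=> 1)) //.
by rewrite sum1_card card_ord.
Qed.

Lemma card_greater_inj d (T : finOrderType d) (A : {set T}) :
  {in A &, injective (fun x => #|[set y in A | (x < y)%O]|)}.
Proof.
have card_greater_lt x y : y \in A -> (x < y)%O ->
    #|[set z in A | (y < z)%O]| < #|[set z in A | (x < z)%O]|.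
  move=> yA xy; apply/proper_card/properP; split.
    by apply/subsetP => z; rewrite !inE => /andP[-> /(lt_trans xy)].
  by exists y; rewrite inE yA ?xy // ltxx.
move=> x y xA yA /= eq_card; case: (ltgtP x y) => // [xy|yx].
  by have := card_greater_lt x y yA xy; rewrite eq_card ltnn.
by have := card_greater_lt y x xA yx; rewrite eq_card ltnn.
Qed.

Section PermutationImages.
Variable T : finType.
Implicit Types (s t : {perm T}) (A : {set T}).

Lemma imset_permC s A : s @: (~: A) = ~: (s @: A).
Proof. by rewrite -!preim_permV preimsetC. Qed.

Lemma eq_out_imset_perm s t A :
  {in ~: A, s =1 t} -> s @: A = t @: A.
Proof.
by move=> eq_st; apply: setC_inj; rewrite -!imset_permC; apply: eq_in_imset.
Qed.

End PermutationImages.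

Section BooleanArrays.
Variable n : nat.
Implicit Types (b : bool_array n) (p q : tri_pos n).

Lemma tri_pos_bounds p : tri_row p < n /\ n - tri_row p <= tri_col p < n.
Proof.
split; first exact: ltn_ord.
by apply/andP; split; [apply: (valP p) | apply: ltn_ord].
Qed.

Lemma tri_pos_exists i j : i < n -> n - i <= j < n ->
  exists2 p : tri_pos n, tri_row p = i & tri_col p = j.
Proof.
move=> i_n /andP[ij j_n].
by exists (exist _ (Ordinal i_n, Ordinal j_n) ij : tri_pos n).
Qed.

Lemma tri_pos_inj p q : tri_row p = tri_row q -> tri_col p = tri_col q -> p = q.
Proof.
case: p q => [[i j] pij] [[k l] pkl]; rewrite /tri_row /tri_col /=.
by move=> eq_ik eq_jl; apply/val_inj; congr (_, _); apply/val_inj.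
Qed.

Lemma num_zeros_rowE b i : i < n ->
  num_zeros_row b i = count (fun j => ~~ entry b i j) (index_iota (n - i) n).
Proof.
move=> i_n; rewrite -sum1_count big_geq_mkord sum1dep_card /num_zeros_row.
set row_positions := [set p : tri_pos n | _].
have col_inj : {in row_positions &, injective (fun p : tri_pos n => (val p).2)}.
  move=> p q; rewrite !inE => /andP[/eqP rp _] /andP[/eqP rq _] eq_col.
  by apply: tri_pos_inj; rewrite ?rp ?rq // /tri_col eq_col.
rewrite -(card_in_imset col_inj); apply: eq_card => j.
rewrite inE; apply/imsetP/andP => [[p]|[zero_ij ij]].
  rewrite inE => /andP[/eqP <- zero_p] ->.
  by rewrite entryE (valP p).
have [|p rp cp] := @tri_pos_exists i j i_n; first by rewrite ij ltn_ord.
by exists p; [rewrite inE -entryE rp cp eqxx | apply/val_inj].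
Qed.

Lemma num_zeros_row_le b i : i < n -> num_zeros_row b i <= i.
Proof.
move=> i_n; rewrite num_zeros_rowE //.
by apply: leq_trans (count_size _ _) _; rewrite size_iota; lia.
Qed.

Lemma num_zeros_rows b : num_zeros b = \sum_(i < n) num_zeros_row b i.
Proof.
rewrite /num_zeros -sum1dep_card (partition_big (fun p => (val p).1) predT) //=.
apply: eq_bigr => i _; rewrite sum1dep_card; apply: eq_card => p.
by rewrite !inE andbC.
Qed.

Section RowsDecreasing.
Variable b : bool_array n.
Hypothesis b_decr : rows_decreasing b.

Lemma rows_decreasing_entry i j k :
  n - i <= j <= k -> entry b i k -> entry b i j.
Proof.
case/andP=> ij /subnKC<-; elim: (k - j) => [|d IHd]; first by rewrite addn0.
rewrite addnS => /existsP[q /and3P[/eqP rq /eqP cq bq]]; apply: IHd.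
have [] := tri_pos_bounds q; rewrite rq cq => i_n /andP[_ j_n].
have [|p rp cp] := @tri_pos_exists i (j + d) i_n; first by lia.
rewrite -rp -cp entryE; have /forallP/(_ p)/forallP/(_ q)/implyP := b_decr.
by rewrite rp rq cp cq !eqxx bq lt0b; apply.
Qed.

Lemma rows_decreasing_is_tsscpp : is_tsscpp b.
Proof.
apply/forallP => j; apply/forallP => i'; apply/implyP => /andP[j0 ji].
rewrite big_ltn ?ltnS //; apply: leq_add; first exact: leq_b1.
rewrite big_nat_cond [leqRHS]big_nat_cond; apply: leq_sum => i.
rewrite andbT => /andP[lt_ji _].
case: (boolP (entry b i (n - j))) => // entry_ij; rewrite lt0b.
by apply: rows_decreasing_entry entry_ij; lia.
Qed.

Lemma rows_decreasing_cellE p :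
  b p = (tri_col p + num_zeros_row b (tri_row p) < n).
Proof.
have [i_n j_range] := tri_pos_bounds p.
rewrite num_zeros_rowE // -entryE.
apply: (@decreasing_pred_count _ _ (entry b (tri_row p))) => // k l kl _.
exact: rows_decreasing_entry.
Qed.

End RowsDecreasing.
End BooleanArrays.

Definition inversion_sequence (n : nat) := {dffun forall i : 'I_n, 'I_i.+1}.

Lemma card_inversion_sequence n : #|{: inversion_sequence n}| = n`!.
Proof.
rewrite card_dep_ffun foldrE big_map big_enum /= fact_prod big_add1 big_mkord.
by under eq_bigr => i _ do rewrite card_ord.
Qed.

Section TriangleOfInversionSequence.
Variable n : nat.
Implicit Types (e : inversion_sequence n) (b : decreasing_tsscpp n).

Definition array_of_invseq e : bool_array n :=
  [ffun p => tri_col p + e (val p).1 < n].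

Lemma array_of_invseq_decreasing e : rows_decreasing (array_of_invseq e).
Proof.
apply/forallP => p; apply/forallP => q.
apply/implyP => /andP[/eqP eq_row /eqP col_q].
rewrite !ffunE col_q addSn (val_inj eq_row : (val p).1 = (val q).1).
by case: ltnP => // lt_n; rewrite lt0b ltnW.
Qed.

Lemma array_of_invseq_tsscpp e :
  is_tsscpp (array_of_invseq e) && rows_decreasing (array_of_invseq e).
Proof.
have decr := array_of_invseq_decreasing e.
by rewrite rows_decreasing_is_tsscpp.
Qed.

Definition tsscpp_of_invseq e : decreasing_tsscpp n :=
  exist _ (array_of_invseq e) (array_of_invseq_tsscpp e).

Lemma entry_array_of_invseq e (i : 'I_n) j : n - i <= j < n ->
  entry (array_of_invseq e) i j = (j + e i < n).
Proof.
move=> j_range; have [p rp cp] := tri_pos_exists (ltn_ord i) j_range.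
by rewrite -{1}rp -cp entryE ffunE (val_inj rp : (val p).1 = i).
Qed.

Lemma entry_last_col_array_of_invseq e (i : 'I_n) : 0 < i ->
  entry (array_of_invseq e) i (n - 1) = (e i == 0 :> nat).
Proof.
by move=> i0; have i_n := ltn_ord i; rewrite entry_array_of_invseq; lia.
Qed.

Lemma num_zeros_row_array_of_invseq e (i : 'I_n) :
  num_zeros_row (array_of_invseq e) i = e i.
Proof.
rewrite num_zeros_rowE // -[RHS](@count_threshold (n - i) n); last first.
  by rewrite subKn; [apply: (ltn_ord (e i)) | apply: ltnW].
apply: eq_in_count => j; rewrite mem_index_iota => j_range.
by rewrite entry_array_of_invseq // -leqNgt.
Qed.

Definition invseq_of_tsscpp b : inversion_sequence n :=
  [ffun i : 'I_n => Ordinal (num_zeros_row_le (val b) (ltn_ord i) : _ < i.+1)].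

Lemma invseq_of_tsscppK : cancel invseq_of_tsscpp tsscpp_of_invseq.
Proof.
move=> b; have /andP[_ decr] := valP b.
by apply/val_inj/ffunP => p; rewrite (rows_decreasing_cellE decr) !ffunE.
Qed.

Lemma tsscpp_of_invseqK : cancel tsscpp_of_invseq invseq_of_tsscpp.
Proof.
move=> e; apply/ffunP => i; apply/val_inj.
by rewrite ffunE /= num_zeros_row_array_of_invseq.
Qed.

Lemma tsscpp_of_invseq_bij : bijective tsscpp_of_invseq.
Proof.
exists invseq_of_tsscpp; first exact: tsscpp_of_invseqK.
exact: invseq_of_tsscppK.
Qed.

End TriangleOfInversionSequence.

Section LehmerCode.
Variable n : nat.
Implicit Types (s t : 'S_n) (i j l m : 'I_n).

Definition lehmer s i := #|[set j : 'I_n | (j < i) && (s i < s j)]|.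

Lemma lehmer_le s i : lehmer s i <= i.
Proof.
rewrite -[leqRHS](card_ord_ltn (ltnW (ltn_ord i))).
by apply/subset_leq_card/subsetP => j; rewrite !inE => /andP[].
Qed.

Definition lehmer_code s : inversion_sequence n :=
  [ffun i : 'I_n => Ordinal (lehmer_le s i : _ < i.+1)].

Lemma lehmer_codeE s i : lehmer_code s i = lehmer s i :> nat.
Proof. by rewrite ffunE. Qed.

Lemma inversion_number_lehmer s : inversion_number s = \sum_(i < n) lehmer s i.
Proof.
rewrite /inversion_number -sum1dep_card (partition_big snd predT) //=.
apply: eq_bigr => i _; rewrite sum1dep_card /lehmer.
have pair_inj : injective (fun j : 'I_n => (j, i)) by move=> j k [].
rewrite -(card_imset _ pair_inj).
apply: eq_card => -[j k]; rewrite !inE /=; apply/idP/imsetP.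
  by case/andP => inv_ji /eqP <-; exists j; rewrite ?inE.
by case=> j'; rewrite inE => inv_ji [-> ->]; rewrite inv_ji eqxx.
Qed.

Lemma lehmer_imset s i :
  lehmer s i = #|[set x in s @: [set j : 'I_n | j <= i] | s i < x]|.
Proof.
have s_inj := @perm_inj _ s.
rewrite -[LHS](card_imset _ s_inj); apply: eq_card => x.
rewrite -[x](permKV s); move: (s^-1%g x) => j.
rewrite inE !(mem_imset _ _ s_inj) !inE.
by case: (ltngtP j i) => // eq_ji; rewrite (val_inj eq_ji) ltnn.
Qed.

(* By descending induction on [i]: [s] and [t] agree beyond [i], so [s i] and
   [t i] lie in the same set of remaining values, where they have the same
   rank. *)
Lemma lehmer_inj s t : lehmer s =1 lehmer t -> s = t.
Proof.
move=> eq_lehmer; apply/permP.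
suff agree_from d : forall i : 'I_n, n - d <= i -> s i = t i.
  by move=> i; apply: (agree_from n); rewrite subnn.
elim: d => [|d IHd] i le_i; first by have := ltn_ord i; lia.
have same_values : s @: [set j : 'I_n | j <= i] = t @: [set j : 'I_n | j <= i].
  apply: eq_out_imset_perm => j; rewrite !inE -ltnNge => lt_ij.
  by apply: IHd; lia.
have := eq_lehmer i; rewrite !lehmer_imset same_values.
apply: card_greater_inj; first rewrite -same_values.
  by apply: imset_f; rewrite inE.
by apply: imset_f; rewrite inE.
Qed.

Lemma lehmer_code_bij : bijective lehmer_code.
Proof.
apply: inj_card_bij; last by rewrite card_inversion_sequence card_Sn.
move=> s t /ffunP eq_code; apply: lehmer_inj => i.
by rewrite -!lehmer_codeE eq_code.
Qed.

Lemma lehmer_last s i : i.+1 = n -> lehmer s i = n - (s i).+1.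
Proof.
move=> i_last; have <- : #|~: [set x : 'I_n | x < (s i).+1]| = n - (s i).+1.
  by rewrite cardsCs setCK card_ord card_ord_ltn.
rewrite lehmer_imset; apply: eq_card => x; rewrite !inE ltnS -ltnNge.
apply: andb_idl => _; rewrite -[x](permKV s); apply: imset_f.
by rewrite inE -ltnS i_last ltn_ord.
Qed.

Lemma lehmer_at_max s m l : m.+1 = n -> s l = m -> lehmer s l = 0.
Proof.
move=> m_last sl; apply: eq_card0 => j; rewrite !inE sl andbC.
by have := ltn_ord (s j); case: ltnP => //; lia.
Qed.

Lemma lehmer_after_max s m l i :
  m.+1 = n -> s l = m -> l < i -> 0 < lehmer s i.
Proof.
move=> m_last sl lt_li; apply/card_gt0P; exists l; rewrite inE lt_li sl /=.
rewrite ltn_neqAle -ltnS m_last ltn_ord andbT -sl.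
rewrite (inj_eq val_inj) (inj_eq perm_inj).
by apply: contraTneq lt_li => ->; rewrite ltnn.
Qed.

End LehmerCode.

Section PermutationMatrix.
Variable n : nat.
Implicit Types (P : permutation_matrix n) (s : 'S_n).

Lemma permutation_matrix_perm_mx P : exists s, val P == perm_mx s.
Proof. exact/existsP/(valP P). Qed.

Definition perm_of_mx P : 'S_n := xchoose (permutation_matrix_perm_mx P).

Lemma perm_of_mxK P : perm_mx (perm_of_mx P) = val P.
Proof. exact/esym/eqP/(xchooseP (permutation_matrix_perm_mx P)). Qed.

Lemma perm_of_mx_eq1 P i j : val P i j = 1%R -> perm_of_mx P i = j.
Proof. by rewrite -perm_of_mxK !mxE; case: eqP. Qed.

Lemma perm_of_mx_unique P s :
  (forall i, val P i (s i) = 1%R) -> perm_of_mx P = s.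
Proof. by move=> Ps; apply/permP => i; apply: perm_of_mx_eq1. Qed.

Lemma perm_of_mx_bij : bijective perm_of_mx.
Proof.
exists (fun s => exist _ (perm_mx s) (perm_mx_is_perm _ s)) => [P|s].
  by apply/val_inj; rewrite /= perm_of_mxK.
by apply: perm_of_mx_unique => i; rewrite !mxE eqxx.
Qed.

End PermutationMatrix.

(* Row and column indices of matrices are elements of 'I_n, hence 0-based:
   the 1-based column k and row l of the informal text are k.+1 and l.+1. *)
Theorem theorem3p5 (n : nat) (hn : 2 <= n) :
  exists Phi : permutation_matrix n -> decreasing_tsscpp n,
    bijective Phi /\
    forall P : permutation_matrix n,
      let M : 'M[int]_n := val P in
      let b : bool_array n := val (Phi P) in
      [/\ forall s : 'S_n, (forall i : 'I_n, M i (s i) = 1%R) ->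
            num_zeros b = inversion_number s,
          forall last k : 'I_n, last.+1 = n -> M last k = 1%R ->
            num_zeros_row b (n - 1) = n - k.+1
        & forall last l : 'I_n, last.+1 = n -> M l last = 1%R ->
            (forall i : nat, l.+1 <= i <= n - 1 ->
               entry b i (n - 1) = false) /\
            (2 <= l.+1 -> entry b (l.+1 - 1) (n - 1) = true)].
Proof.
exists (@tsscpp_of_invseq n \o (@lehmer_code n \o @perm_of_mx n)); split.
  apply: bij_comp (@tsscpp_of_invseq_bij n) _.
  exact: bij_comp (@lehmer_code_bij n) (@perm_of_mx_bij n).
move=> P M b; split.
- move=> s /perm_of_mx_unique <-.
  rewrite num_zeros_rows inversion_number_lehmer; apply: eq_bigr => i _.
  by rewrite num_zeros_row_array_of_invseq lehmer_codeE.
- move=> last k last_n /perm_of_mx_eq1 <-.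
  have -> : n - 1 = last by lia.
  by rewrite num_zeros_row_array_of_invseq lehmer_codeE lehmer_last.
move=> last l last_n /perm_of_mx_eq1 Pl; split=> [i /andP[li i_n]|l0].
  have lt_i : i < n by lia.
  rewrite (@entry_last_col_array_of_invseq _ _ (Ordinal lt_i)).
    by rewrite lehmer_codeE eqn0Ngt (lehmer_after_max last_n Pl).
  exact: leq_trans li.
rewrite subSS subn0 entry_last_col_array_of_invseq // lehmer_codeE.
by rewrite (lehmer_at_max last_n Pl).
Qed.
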